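(* Let $(X,\perp,d)$ be a weak orthogonal metric space and let $T:X\to X$ be a self map such that $X$ is $T$-orbitally $O_w$-complete. Suppose that $T$ is weak orthogonality preserving, that $T$ is orbitally $O_w$-continuous (at every point of $X$), and that $T$ is a generalized $\perp$-contraction for some $k\in[0,1)$. Then $T$ has a unique fixed point in $X$.
   Context: Weak orthogonal set: a non-empty set $X$ with a binary relation $\perp$ on $X$ for which there exists $x_0\in X$ such that for every $y\in X$, $x_0\perp y$ or $y\perp x_0$ (which alternative holds may depend on $y$). A weak orthogonal metric space ($O_w$-metric space) $(X,\perp,d)$ is a weak orthogonal set $(X,\perp)$ together with a metric $d$ on $X$. Two elements $x,y\in X$ are orthogonally related if $x\perp y$ or $y\perp x$. A sequence $\{x_n\}_{n\in\mathbb N}$ in $X$ is an $O_w$-sequence if for every $n\in\mathbb N$, $x_n\perp x_{n+1}$ or $x_{n+1}\perp x_n$. A Cauchy $O_w$-sequence is an $O_w$-sequence that is Cauchy with respect to $d$. For $T:X\to X$ and $x\in X$, the orbit of $T$ at $x$ is $O_T(x)=\{T^n x: n=0,1,2,\dots\}$. A sequence is said to be in $O_T(x)$ if all its terms belong to $O_T(x)$. $T$ is weak orthogonality preserving if for all $x,y\in X$, $x\perp y$ implies $Tx\perp Ty$ or $Ty\perp Tx$. $T$ is orbitally $O_w$-continuous at $z\in X$ if for every $x\in X$ and every $O_w$-sequence $\{y_n\}_{n\in\mathbb N}$ in $O_T(x)$, $y_n\to z$ implies $Ty_n\to Tz$. $X$ is $T$-orbitally $O_w$-complete if for every $x\in X$,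 every Cauchy $O_w$-sequence in $O_T(x)$ converges to a point of $X$. $T$ is a generalized $\perp$-contraction (with constant $k$) if $d(Tx,Ty)\le k\,M(x,y)$ for all orthogonally related $x,y\in X$, where $$M(x,y)=\max\Big\{d(x,y),\,d(x,Tx),\,d(y,Ty),\,\tfrac{d(x,Ty)+d(Tx,y)}{2},\,\tfrac{d(T^2x,x)+d(T^2x,Ty)}{2},\,d(T^2x,Tx),\,d(T^2x,y),\,d(T^2x,Ty)\Big\}.$$ *)

(* Defs.v *)
From mathcomp Require Import all_boot all_order all_algebra.
From mathcomp Require Import all_classical all_reals all_analysis.

Set Implicit Arguments.
Unset Strict Implicit.
Unset Printing Implicit Defensive.

Import Order.TTheory GRing.Theory Num.Theory.

Local Open Scope classical_set_scope.
Local Open Scope ring_scope.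

(* Non-emptiness of X is part of the existential. *)
Definition weak_orthogonal_set (X : Type) (perp : X -> X -> Prop) : Prop :=
  exists x0 : X, forall y : X, perp x0 y \/ perp y x0.

Definition orth_related (X : Type) (perp : X -> X -> Prop) (x y : X) : Prop :=
  perp x y \/ perp y x.

Definition Ow_sequence (X : Type) (perp : X -> X -> Prop) (u : nat -> X) : Prop :=
  forall n : nat, orth_related perp (u n) (u n.+1).

Definition orbit_of (X : Type) (T : X -> X) (x : X) : set X :=
  range (fun n : nat => iter n T x).

Definition weak_orth_preserving (X : Type) (perp : X -> X -> Prop)
    (T : X -> X) : Prop :=
  forall x y : X, perp x y -> perp (T x) (T y) \/ perp (T y) (T x).

Section OrthogonalMetric.
Context {R : realType} {X : metricType R}.
Implicit Types (perp : X -> X -> Prop) (T : X -> X).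

(* The terms of u may visit the orbit in any order, with repetitions. *)
Definition orbitally_Ow_continuous_at perp T (z : X) : Prop :=
  forall (x : X) (u : nat -> X),
    Ow_sequence perp u -> (forall n, orbit_of T x (u n)) ->
    u n @[n --> \oo] --> z -> T (u n) @[n --> \oo] --> T z.

Definition orbitally_Ow_complete perp T : Prop :=
  forall (x : X) (u : nat -> X),
    Ow_sequence perp u -> (forall n, orbit_of T x (u n)) ->
    cauchy (u n @[n --> \oo]) ->
    exists z : X, u n @[n --> \oo] --> z.

Definition contraction_max T (x y : X) : R :=
  let d := @mdist R X in
  let T2x := T (T x) in
  Num.max (d x y)
  (Num.max (d x (T x))
  (Num.max (d y (T y))
  (Num.max ((d x (T y) + d (T x) y) / 2)
  (Num.max ((d T2x x + d T2x (T y)) / 2)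
  (Num.max (d T2x (T x))
  (Num.max (d T2x y)
           (d T2x (T y)))))))).

Definition generalized_orth_contraction perp T (k : R) : Prop :=
  forall x y : X, orth_related perp x y ->
    mdist (T x) (T y) <= k * contraction_max T x y.

End OrthogonalMetric.

(* Main.v *)
Require Import Defs.
From mathcomp Require Import all_boot all_order all_algebra.
From mathcomp Require Import all_classical all_reals all_analysis.
From mathcomp Require Import lra.

(** Let [x0] be a point related to every point.  The Picard iterates
    [x n = iter n T x0] carry the whole argument: since [T] preserves the
    relation, [x n] is related to [iter n T y] for every [y].  Two choices of
    [y] matter.

    With [y = T x0], consecutive iterates are related.  On a pair [(p, T p)] the
    eight terms of [contraction_max] reduce to the two steps [d p (T p)] and
    [d (T p) (T (T p))], and the second one can be discarded because [k < 1]
    ([absorb_max]).  Hence the steps decay like [k ^+ n], the iterates form a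
    Cauchy sequence with related consecutive terms ([geometric_steps_cauchy]),
    completeness gives a limit [z], and continuity turns
    [x n.+1 = T (x n)] into [z = T z].

    With [y = w] a fixed point, [w] is related to every iterate.  The contraction
    applied to [(w, x n)] then bounds [d w (x n.+1)] by [k] times [d w (x n)]
    plus the vanishing step [d (x n) (x n.+1)].  In the limit
    [d w z <= k * d w z], so [w = z]. *)

Set Implicit Arguments.
Unset Strict Implicit.
Unset Printing Implicit Defensive.

Import Order.TTheory GRing.Theory Num.Theory.
Import numFieldNormedType.Exports.

Local Open Scope classical_set_scope.
Local Open Scope ring_scope.

(** * Propagation of the relation along orbits *)

Lemma orth_related_iter (X : Type) (perp : X -> X -> Prop) (T : X -> X)
    (n : nat) (x y : X) :
  weak_orth_preserving perp T -> orth_related perp x y ->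
  orth_related perp (iter n T x) (iter n T y).
Proof.
move=> Hpres xy; elim: n => [//|n [] /Hpres] /=; rewrite /orth_related; tauto.
Qed.

(** * Metric preliminaries *)

(** If the maximum were [x], then [x <= k * x] with [k < 1] would force
    [x <= 0 <= a], so the maximum is [a] in any case. *)
Lemma absorb_max (R : realType) (k a x : R) :
  0 <= k -> k < 1 -> 0 <= a -> x <= k * Num.max a x -> x <= k * a.
Proof.
move=> k0 k1 a0; case: (ltP a x) => // ax xkx.
have : 0 < (1 - k) * x by rewrite mulr_gt0 ?subr_gt0// (le_lt_trans a0 ax).
by lra.
Qed.

Lemma cvg_succ (Y : topologicalType) (u : nat -> Y) (l : Y) :
  u n @[n --> \oo] --> l -> u n.+1 @[n --> \oo] --> l.
Proof.
move=> ul A /ul [N _ uA]; exists N => // n /= Nn.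
by apply: uA; exact: leqW.
Qed.

Lemma cvg_mdistr (R : realType) (X : metricType R) (u : nat -> X) (w z : X) :
  u n @[n --> \oo] --> z -> mdist w (u n) @[n --> \oo] --> mdist w z.
Proof.
move=> uz; apply/cvgrPdist_lt => e e0.
move/cvg_ballP: uz => /(_ e e0); apply: filterS => n.
rewrite ballEmdist/= => zun.
apply: le_lt_trans zun; rewrite ler_norml.
have := metric_triangle w (u n) z; have := metric_triangle w z (u n).
by rewrite (metric_sym (u n) z); lra.
Qed.

Section GeometricSteps.
Context {R : realType} {X : metricType R}.
Variables (u : nat -> X) (k c : R).
Hypotheses (k0 : 0 <= k) (k1 : k < 1).
Hypothesis steps : forall n, mdist (u n) (u n.+1) <= k ^+ n * c.

(** The geometric sum, cleared of its denominator [1 - k] so that the induction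
    on [m] telescopes. *)
Lemma geometric_steps_mdist (n m : nat) :
  (1 - k) * mdist (u n) (u (n + m)%N) <= (k ^+ n - k ^+ (n + m)) * c.
Proof.
elim: m => [|m IH]; first by rewrite addn0 mdistxx; lra.
have tri := metric_triangle (u n) (u (n + m)%N) (u (n + m.+1)%N).
have := steps (n + m)%N; rewrite -addnS => step.
have : (1 - k) * mdist (u n) (u (n + m.+1)%N) <=
    (1 - k) * (mdist (u n) (u (n + m)%N) + k ^+ (n + m) * c).
  by rewrite ler_wpM2l ?subr_ge0 ?(ltW k1)//; lra.
rewrite addnS exprS => le1; lra.
Qed.

Lemma geometric_steps_cvg0 : k ^+ n * c @[n --> \oo] --> 0.
Proof.
rewrite -[X in _ --> X](mul0r c); apply: cvgMr_tmp.
by apply: cvg_expr; rewrite ger0_norm.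
Qed.

Lemma geometric_steps_cauchy : cauchy (u n @[n --> \oo]).
Proof.
have c0 : 0 <= c.
  by have := steps 0; rewrite expr0 mul1r; apply: le_trans; exact: mdist_ge0.
apply: cauchy_exP => e e0.
have ke0 : 0 < (1 - k) * e by rewrite mulr_gt0// subr_gt0.
have [N _ small] := cvgr0_norm_lt _ geometric_steps_cvg0 _ ke0.
exists (u N); exists N => // n /= Nn.
rewrite ballEmdist/= -(subnKC Nn) -(ltr_pM2l (_ : 0 < 1 - k)) ?subr_gt0//.
apply: le_lt_trans (geometric_steps_mdist N (n - N)) _.
have := small N (leqnn N); apply: le_lt_trans.
apply: le_trans (ler_norm _); rewrite ler_wpM2r// gerBl exprn_ge0//.
Qed.

End GeometricSteps.

(** * The contraction on the two relevant kinds of pairs *)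

Section ContractionMax.
Context {R : realType} {X : metricType R}.
Variable T : X -> X.

(** On [(x, T x)] the terms of [contraction_max] that are neither zero nor steps
    of the orbit are halves of [d x (T (T x))], hence at most the mean of the two
    steps by the triangle inequality. *)
Lemma contraction_max_step (x : X) :
  contraction_max T x (T x) <=
  Num.max (mdist x (T x)) (mdist (T x) (T (T x))).
Proof.
rewrite /contraction_max !mdistxx.
have tri := metric_triangle x (T x) (T (T x)).
rewrite (metric_sym (T (T x)) x) (metric_sym (T (T x)) (T x)).
have d1 := mdist_ge0 x (T x); have d2 := mdist_ge0 (T x) (T (T x)).
rewrite !ge_max !le_max !lexx ?orbT d1/=.
by case: (leP (mdist x (T x)) (mdist (T x) (T (T x)))) => ?;
   rewrite ?andbT; repeat (apply/andP; split); apply/orP; (left; lra) || (right; lra).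
Qed.

(** The fixed point goes in the first slot, so that every term containing
    [T (T w)] becomes a distance from [w]; on [(y, w)] the iterate [T (T y)]
    would remain. *)
Lemma contraction_max_fixed (w y : X) : T w = w ->
  contraction_max T w y <=
  Num.max (Num.max (mdist w y) (mdist y (T y))) (mdist w (T y)).
Proof.
move=> Tw; rewrite /contraction_max !Tw !mdistxx.
have d1 := mdist_ge0 w y; have d2 := mdist_ge0 w (T y).
rewrite !ge_max !le_max !lexx ?orbT d1/= ?andbT.
by case: (leP (mdist w y) (mdist w (T y))) => ?;
   repeat (apply/andP; split); rewrite -?orbA; lra.
Qed.

End ContractionMax.

Section Contraction.
Context {R : realType} {X : metricType R}.
Variables (perp : X -> X -> Prop) (T : X -> X) (k : R).
Hypotheses (k0 : 0 <= k) (k1 : k < 1).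
Hypothesis Hcontr : generalized_orth_contraction perp T k.

Lemma contraction_step (x : X) : orth_related perp x (T x) ->
  mdist (T x) (T (T x)) <= k * mdist x (T x).
Proof.
move=> /Hcontr le; apply: absorb_max => //; first exact: mdist_ge0.
by apply: le_trans le _; rewrite ler_wpM2l// contraction_max_step.
Qed.

(** The maximum is relaxed to a sum so that the bound passes to the limit along
    the iterates by continuity of addition. *)
Lemma contraction_fixed (w y : X) : T w = w -> orth_related perp w y ->
  mdist w (T y) <= k * (mdist w y + mdist y (T y)).
Proof.
move=> Tw /Hcontr; rewrite Tw => le.
have d1 := mdist_ge0 w y; have d2 := mdist_ge0 y (T y).
have : mdist w (T y) <= k * Num.max (mdist w y) (mdist y (T y)).
  apply: absorb_max; rewrite ?le_max ?d1//.
  by apply: le_trans le _; rewrite ler_wpM2l// contraction_max_fixed.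
by move/le_trans; apply; rewrite ler_wpM2l// ge_max lerDl lerDr d1 d2.
Qed.

Lemma iter_steps (x : X) :
  (forall n, orth_related perp (iter n T x) (iter n.+1 T x)) ->
  forall n, mdist (iter n T x) (iter n.+1 T x) <= k ^+ n * mdist x (T x).
Proof.
move=> rel; elim=> [|n IH]; first by rewrite expr0 mul1r.
apply: le_trans (contraction_step (rel n)) _.
by rewrite exprS -mulrA ler_wpM2l.
Qed.

End Contraction.

(** * Existence and uniqueness of the fixed point *)

Theorem theorem2p2 (R : realType) (X : metricType R) (perp : X -> X -> Prop)
    (T : X -> X) (k : R)
    (Hperp : weak_orthogonal_set perp)
    (Hcomplete : orbitally_Ow_complete perp T)
    (Hpres : weak_orth_preserving perp T)
    (Hcont : forall z : X, orbitally_Ow_continuous_at perp T z)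
    (Hk0 : 0 <= k) (Hk1 : k < 1)
    (Hcontr : generalized_orth_contraction perp T k) :
  exists! z : X, T z = z.
Proof.
have [x0 x0rel] := Hperp.
pose x n := iter n T x0.
have xOw : Ow_sequence perp x.
  by move=> n; rewrite /x iterSr; apply: orth_related_iter.
have xorb n : orbit_of T x0 (x n) by exists n.
have steps := iter_steps Hk0 Hk1 Hcontr xOw.
have [z xz] := Hcomplete x0 x xOw xorb (geometric_steps_cauchy Hk0 Hk1 steps).
exists z; split.
  have Txz := Hcont z x0 x xOw xorb xz.
  apply: (cvg_unique (@metric_hausdorff _ X) Txz).
  exact: cvg_succ xz.
move=> w Tw.
have wx n : orth_related perp w (x n).
  by rewrite -(iter_fix n Tw) /orth_related or_comm; apply: orth_related_iter.
have bound n :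
    mdist w (x n.+1) <= k * (mdist w (x n) + k ^+ n * mdist x0 (T x0)).
  apply: le_trans (contraction_fixed Hk0 Hk1 Hcontr Tw (wx n)) _.
  by rewrite ler_wpM2l// lerD2l; exact: steps.
have wxz := cvg_mdistr (w := w) xz.
have lim : mdist w z <= k * (mdist w z + 0).
  apply: (ler_cvg_to (cvg_succ wxz) _ (nearW _ bound)).
  by apply: cvgMl_tmp; apply: cvgD => //; exact: geometric_steps_cvg0.
have d0 := mdist_ge0 w z.
by apply/esym/mdist_positivity/eqP; rewrite eq_le d0 andbT; nra.
Qed.
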